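(* Consider the (static) lowest unique bid auction game with exactly two bidders, $n=2$, with object value $v$ and bidding cost $c$. Then there is a unique symmetric equilibrium $(\sigma,\sigma)$. Let $N$ be the maximal natural number (among those with $N<v$) that satisfies $$\frac{c}{v-1}+\frac{c}{v-2}+\cdots+\frac{c}{v-N}<1.$$ The strategy $\sigma$ is defined by: (i) $\sigma(\varnothing)=\dfrac{c}{v-1}$; (ii) $\sigma(\{1,\dots,l\})=\dfrac{c}{v-(l+1)}$ for $l=1,2,\dots,N-1$; (iii) $\sigma(\{1,\dots,N\})=1-\displaystyle\sum_{l=0}^{N-1}\frac{c}{v-(l+1)}$.
   Context: The lowest unique bid auction game: there is an object of common value $v$, a fixed cost $c>0$ per bid, and a set of bidders $\mathcal{B}=\{1,\dots,n\}$. Here $\mathbb{N}$ denotes the positive integers. Simultaneously and independently, each bidder $i$ submits a finite (possibly empty) set $S_i\subset\mathbb{N}$ of bids. Let $S_*=\{s\in\mathbb{N}: \#\{i\in\mathcal{B}: s\in S_i\}=1\}$ be the set of integers bid by exactly one bidder. If $S_*=\varnothing$ there is no winner. If $S_*\neq\varnothing$, the winning bid is $s_*=\min(S_* )$ and the winner $i_*$ is the unique bidder with $s_*\in S_{i_*}$. The payoff of bidder $i$ is $u_i(S_1,\dots,S_n)=-c|S_i|+v-s_*$ if $i$ is the winner, and $u_i(S_1,\dots,S_n)=-c|S_i|$ otherwise. A pure strategy is a finite subset of $\mathbb{N}$; a mixed strategy $\sigma$ is a probability distribution over pure strategies, $\sigma(S)$ being the probability of the set $S$. For equilibrium analysis strategies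 are taken to be bounded: no bidder bids more than $v$, and no bidder makes more than $v/c$ bids. Bidders maximize expected payoff, and ''equilibrium'' means Nash equilibrium in mixed strategies. An equilibrium is symmetric if all bidders use the same mixed strategy. *)

(* Defs.v *)
From mathcomp Require Import all_boot all_order all_algebra finmap.
From mathcomp Require Import reals.

Set Implicit Arguments.
Unset Strict Implicit.
Unset Printing Implicit Defensive.

Import Order.TTheory GRing.Theory Num.Theory.

Local Open Scope fset_scope.
Local Open Scope ring_scope.

Section Outcome.
Variables (n : nat) (S : 'I_n -> {fset nat}).

Definition lone_bids : {fset nat} :=
  [fset s in (\bigcup_(i <- enum 'I_n) S i)%fset | #|[set i | s \in S i]| == 1%N].

Definition winning_bid : option nat :=
  omap val [pick s : lone_bids | [forall t : lone_bids, (val s <= val t)%N]].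

End Outcome.

Section Game.
Variables (R : realType) (v c : R) (n : nat).

Definition payoff (S : 'I_n -> {fset nat}) (i : 'I_n) : R :=
  - (c * #|` S i|%:R) +
  (if winning_bid S is Some s then if s \in S i then v - s%:R else 0 else 0).

Definition bounded (S : {fset nat}) : bool :=
  [&& 0%N \notin S, [forall s : S, (val s)%:R <= v] & #|` S|%:R <= v / c].

(* The power set only serves to exhibit the bounded strategies as a finite    *)
(* set; see in_strategies.                                                    *)
Definition strategies : {fset {fset nat}} :=
  [fset S in fpowerset [fset s in iota 0 (Num.truncn v).+1] | bounded S].

Lemma in_strategies S : (S \in strategies) = bounded S.
Proof.
rewrite !inE /= andbC; case: (boolP (bounded S)) => //= /and3P[_ /forallP h _].
rewrite fpowersetE; apply/fsubsetP => s sS.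
have -> : (s \in [fset x in iota 0 (Num.truncn v).+1]) = (s <= Num.truncn v)%N.
  by rewrite in_fset mem_iota.
have /= sv := h [` sS].
by rewrite truncn_ge_nat // (le_trans _ sv).
Qed.

(* Mixed strategies are given by their probability mass functions.            *)
Definition mixed (sigma : {fset nat} -> R) : Prop :=
  [/\ forall S, 0 <= sigma S,
      forall S, ~~ bounded S -> sigma S = 0
    & \sum_(S : strategies) sigma (val S) = 1].

Definition expected_payoff (sigma : 'I_n -> {fset nat} -> R) (i : 'I_n) : R :=
  \sum_(S : {ffun 'I_n -> strategies})
    (\prod_(j < n) sigma j (val (S j))) * payoff (fun j => val (S j)) i.

Definition equilibrium (sigma : 'I_n -> {fset nat} -> R) : Prop :=
  (forall i, mixed (sigma i)) /\
  forall i tau, mixed tau ->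
    expected_payoff (fun j => if j == i then tau else sigma j) i
      <= expected_payoff sigma i.

Definition symmetric_equilibrium (sigma : {fset nat} -> R) : Prop :=
  equilibrium (fun=> sigma).

End Game.

Definition initial (l : nat) : {fset nat} := [fset s in iota 1 l].

Definition admissible (R : realType) (v c : R) (N : nat) : Prop :=
  [/\ (0 < N)%N, N%:R < v & \sum_(1 <= k < N.+1) c / (v - k%:R) < 1].

Definition maximal_admissible (R : realType) (v c : R) (N : nat) : Prop :=
  admissible v c N /\ forall M, admissible v c M -> (M <= N)%N.

(* Main.v *)
(* With two bidders, S wins against T exactly when the minimum m of their       *)
(* symmetric difference lies in S, that is, when S is larger in a lexicographic *)
(* order on finite sets; S then gets v - m.                                     *)
(*                                                                              *)
(* Uniqueness: in a symmetric equilibrium the smallest set of the support never *)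
(* wins, so it must be empty and the equilibrium value is 0.  Inductively, if   *)
(* the support starts with {}, {1}, .., {1..K} and S is its next element, then  *)
(* {1..K} is a proper subset of S, and replacing S by {1..K+1} saves bids and   *)
(* lowers the winning bid.  As both values are at most 0 and the one of S is 0, *)
(* S = {1..K+1}, and indifference gives sigma {1..K} (v - (K+1)) = c.  The last *)
(* K is the one for which the weights sum to less than 1 while the deviation to *)
(* {1..K+1} is not profitable, which determines it.                             *)
(*                                                                              *)
(* Existence: against the resulting sigma, each of the {1..l} properly included *)
(* in S contributes at most c to the gain of S, and there are at most |S| such  *)
(* sets, so no strategy has a positive value.                                   *)

Require Import Defs.
From mathcomp Require Import all_boot all_order all_algebra finmap.
From mathcomp Require Import reals boolp lra.

Set Implicit Arguments.
Unset Strict Implicit.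
Unset Printing Implicit Defensive.

Import Order.TTheory GRing.Theory Num.Theory.

Local Open Scope fset_scope.
Local Open Scope ring_scope.

(** With two bidders the payoff depends only on the order [beats] and on the deciding bid
    ([payoff_gain]). The strategies that beat {1..l} are exactly its proper supersets
    ([beats_initial]); among these, {1..l+1} has the fewest bids and wins with the lowest bid.

    [symmetric_equilibriumP] turns equilibrium into indifference on the support. Uniqueness climbs
    the support in this order: [support_fset0] is the base, [chain_step] the induction, and
    [chain_end_staircase] reads off the weights. Existence combines [value_staircase_le0] with
    [value_staircase_initial]. Both directions meet at one threshold, unique by [last_good_uniq],
    which is the N of the theorem whenever that N exists ([maximal_admissible_last_good]). *)

Lemma neq_ord2 (i j : 'I_2) : (j != i) = (j == rev_ord i).
Proof. by case: i j => [[|[|?]] ?] [[|[|?]] ?]. Qed.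

Lemma big_ord2 (T : Type) (idx : T) (op : Monoid.com_law idx) (F : 'I_2 -> T) i :
  \big[op/idx]_(j < 2) F j = op (F i) (F (rev_ord i)).
Proof.
rewrite (bigD1 i) //=; congr (op _ _).
by rewrite (big_pred1 (rev_ord i)) // => j; rewrite neq_ord2.
Qed.

(** * The lexicographic order on finite sets of bids *)

Definition undercuts (S T : {fset nat}) (s : nat) : bool :=
  [&& s \in S, s \notin T & [forall t : 'I_s, (val t \in S) == (val t \in T)]].

Definition beats (S T : {fset nat}) : bool := [exists s : S, undercuts S T (val s)].

Lemma undercutsP (S T : {fset nat}) (s : nat) :
  reflect [/\ s \in S, s \notin T & forall t, (t < s)%N -> (t \in S) = (t \in T)]
          (undercuts S T s).
Proof.
apply: (iffP and3P) => -[sS sT h]; split => //.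
  by move=> t ts; apply/eqP; exact: (forallP h (Ordinal ts)).
by apply/forallP => -[t ts]; rewrite h.
Qed.

Lemma beatsP (S T : {fset nat}) : reflect (exists s, undercuts S T s) (beats S T).
Proof.
apply: (iffP existsP) => [[s h]|[s h]]; first by exists (val s).
by have /undercutsP[sS _ _] := h; exists [` sS].
Qed.

Lemma undercuts_inj (S T : {fset nat}) s t :
  undercuts S T s -> undercuts S T t -> s = t.
Proof.
move=> /undercutsP[sS sT hs] /undercutsP[tS tT ht].
by case: (ltngtP s t) => // h; [move: (ht _ h) | move: (hs _ h)];
  rewrite ?sS ?tS ?(negPf sT) ?(negPf tT).
Qed.

Lemma beats_irr (S : {fset nat}) : beats S S = false.
Proof. by apply/negbTE/negP => /beatsP[s /undercutsP[->]]. Qed.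

Lemma beats_trans : transitive beats.
Proof.
move=> T S U /beatsP[s /undercutsP[sS sT hs]] /beatsP[t /undercutsP[tT tU ht]].
apply/beatsP; exists (minn s t); apply/undercutsP; case: (ltngtP s t) => st.
- by rewrite -ht //; split => // u us; rewrite hs // ht // (ltn_trans us).
- by rewrite hs //; split => // u ut; rewrite hs ?ht // (ltn_trans ut).
- by move: sT; rewrite st tT.
Qed.

Lemma beats_total (S T : {fset nat}) : S != T -> beats S T || beats T S.
Proof.
move=> ST; have /ex_minnP[s ms hs] : exists s, (s \in S) != (s \in T).
  apply: contrapT => /forallNP h; case/eqP: ST; apply/fsetP => s.
  by apply/eqP/negPn/negP; exact: h.
have hs' t : (t < s)%N -> (t \in S) = (t \in T).
  by move=> ts; apply/eqP; apply: contraTT ts => /hs; rewrite -leqNgt.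
have [sS|sS] := boolP (s \in S); apply/orP; [left|right]; apply/beatsP; exists s;
  apply/undercutsP; move: ms; rewrite ?sS ?(negPf sS) => ms; split => //.
- by case: (s \in T) ms.
- by move=> t /hs'.
Qed.

Lemma beats_asym (S T : {fset nat}) : beats S T -> ~~ beats T S.
Proof. by move=> ST; apply/negP => /(beats_trans ST); rewrite beats_irr. Qed.

(** An index whose set beats the fewest sets of [P] is minimal, because [beats] is transitive and
    irreflexive. This finds the lowest element of a support. *)
Lemma exists_weakest (I : finType) (f : I -> {fset nat}) (P : pred I) i0 :
  P i0 -> exists2 i, P i & forall j, P j -> f j != f i -> beats (f j) (f i).
Proof.
move=> Pi0.
case: (arg_minnP (fun i => #|[set j | P j && beats (f i) (f j)]|) Pi0) => i Pi mi.
exists i => // j Pj ji; have /orP[//|ij] := beats_total ji.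
have /mi := Pj; rewrite leqNgt => /negP[]; apply: proper_card; apply/properP; split.
  by apply/subsetP => k; rewrite !inE => /andP[-> /(beats_trans ij)->].
by exists j; rewrite !inE Pj ?ij // beats_irr.
Qed.

(** * The winning bid as the minimum of the symmetric difference *)

Section Outcome2.
Variables (f : 'I_2 -> {fset nat}) (i : 'I_2).

Lemma in_lone_bids2 s : (s \in lone_bids f) = (s \in f i) (+) (s \in f (rev_ord i)).
Proof.
have -> : (s \in lone_bids f) = (#|[set j | s \in f j]| == 1)%N.
  rewrite !inE /= andb_idl // => /cards1P[j /setP/(_ j)].
  rewrite !inE eqxx => sj; apply/bigfcupP; exists j => //.
  by rewrite mem_enum.
rewrite -sum1dep_card big_mkcond /= (big_ord2 _ _ i) /=.
by do 2!case: (_ \in _).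
Qed.

Lemma winning_bidP s :
  s \in lone_bids f -> (forall t, t \in lone_bids f -> (s <= t)%N) ->
  winning_bid f = Some s.
Proof.
move=> sf hs; rewrite /winning_bid; case: pickP => /= [t /forallP ht|/(_ [` sf])].
  congr Some; apply/eqP; rewrite eqn_leq hs ?fsvalP // andbT.
  exact: (ht [` sf]).
by move/negP; case; apply/forallP => t; apply: hs; exact: fsvalP.
Qed.

Lemma winning_bid_undercuts s : undercuts (f i) (f (rev_ord i)) s ->
  winning_bid f = Some s.
Proof.
move=> /undercutsP[s1 s2 h]; apply: winning_bidP.
  by rewrite in_lone_bids2 s1 (negPf s2).
move=> t; rewrite in_lone_bids2 leqNgt; apply: contraTN => /h ->.
by rewrite addbb.
Qed.

Lemma winning_bid_eq : f i = f (rev_ord i) -> winning_bid f = None.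
Proof.
move=> e; rewrite /winning_bid; case: pickP => //= t.
by have := fsvalP t; rewrite in_lone_bids2 e addbb.
Qed.

End Outcome2.

(** * Payoff of a pure strategy against a mixed one *)

Section Gain.
Variables (R : realType) (v c : R).

Definition gain (S T : {fset nat}) : R :=
  if [pick s : S | undercuts S T (val s)] is Some s then v - (val s)%:R else 0.

Lemma gain_undercuts S T s : undercuts S T s -> gain S T = v - s%:R.
Proof.
move=> h; rewrite /gain; case: pickP => [t ht|].
  by rewrite (undercuts_inj ht h).
have /undercutsP[sS _ _] := h.
by move/(_ [` sS]); rewrite /= h.
Qed.

Lemma gain0 S T : ~~ beats S T -> gain S T = 0.
Proof.
move=> h; rewrite /gain; case: pickP => // t ht.
by case/negP: h; apply/existsP; exists t.
Qed.

Lemma payoff_gain (f : 'I_2 -> {fset nat}) i :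
  payoff v c f i = gain (f i) (f (rev_ord i)) - c * #|` f i|%:R.
Proof.
rewrite /payoff addrC; congr (_ - _).
have [e|/beats_total/orP[h|h]] := eqVneq (f i) (f (rev_ord i)).
- by rewrite (winning_bid_eq e) gain0 // -e beats_irr.
- have /beatsP[s hs] := h; rewrite (winning_bid_undercuts hs) (gain_undercuts hs).
  by case/undercutsP: hs => ->.
- rewrite (gain0 (beats_asym h)); have /beatsP[s hs] := h.
  have := @winning_bid_undercuts f (rev_ord i) s; rewrite rev_ordK => /(_ hs) ->.
  by case/undercutsP: hs => _ /negPf->.
Qed.

Lemma gain_ge0 S T : bounded v c S -> 0 <= gain S T.
Proof.
move=> /and3P[_ /forallP hS _].
by rewrite /gain; case: pickP => // s _; rewrite subr_ge0 hS.
Qed.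

Definition value (sigma : {fset nat} -> R) (S : {fset nat}) : R :=
  \sum_(T : strategies v c) sigma (val T) * gain S (val T) - c * #|` S|%:R.

Lemma expected_payoff2 (sig : 'I_2 -> {fset nat} -> R) i :
  mixed v c (sig (rev_ord i)) ->
  expected_payoff v c sig i =
    \sum_(S : strategies v c) sig i (val S) * value (sig (rev_ord i)) (val S).
Proof.
(* [h] identifies a pair (own set, opponent's set) with a strategy profile. *)
case=> _ _ sum1; pose h (p : strategies v c * strategies v c) :=
  [ffun j : 'I_2 => if j == i then p.1 else p.2].
have ri : (rev_ord i == i) = false by apply/negbTE; rewrite neq_ord2.
have h1 p : h p i = p.1 by rewrite ffunE eqxx.
have h2 p : h p (rev_ord i) = p.2 by rewrite ffunE ri.
have hb : bijective h.
  exists (fun f : {ffun 'I_2 -> strategies v c} => (f i, f (rev_ord i))) => [p|f].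
    by rewrite h1 h2 -surjective_pairing.
  apply/ffunP => j; rewrite ffunE /=; case: eqVneq => [->//|].
  by rewrite neq_ord2 => /eqP->.
rewrite /expected_payoff (reindex h) /=; last exact: onW_bij.
under eq_bigr => p _ do rewrite payoff_gain (big_ord2 _ _ i) /= h1 h2 -mulrA.
rewrite -(pair_bigA _ (fun S T : strategies v c => sig i (val S) *
  (sig (rev_ord i) (val T) * (gain (val S) (val T) - c * #|` val S|%:R)))) /=.
apply: eq_bigr => S _; rewrite -mulr_sumr; congr (_ * _).
under eq_bigr => T _ do rewrite mulrBr.
by rewrite sumrB -mulr_suml sum1 mul1r.
Qed.

End Gain.

(** * The sets {1..l} in the order *)

Lemma in_initial l s : (s \in initial l) = (0 < s <= l)%N.
Proof. by rewrite in_fset /= mem_iota add1n ltnS. Qed.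

Lemma initial0 : initial 0 = fset0.
Proof. by apply/fsetP => s; rewrite in_initial in_fset0; case: s. Qed.

Lemma initialS l : initial l.+1 = l.+1 |` initial l.
Proof.
apply/fsetP => s; rewrite in_fset1U !in_initial [(s <= l.+1)%N]leq_eqVlt ltnS.
by case: eqVneq => [->|].
Qed.

Lemma card_initial l : #|` initial l| = l.
Proof.
by rewrite /initial card_fseq undup_id ?iota_uniq // size_iota.
Qed.

Lemma sub_initial k l : (k <= l)%N -> initial k `<=` initial l.
Proof.
move=> kl; apply/fsubsetP => s; rewrite !in_initial => /andP[-> /leq_trans]; exact.
Qed.

Lemma undercuts_initial (S : {fset nat}) l :
  0%N \notin S -> initial l.+1 `<=` S -> undercuts S (initial l) l.+1.
Proof.
move=> S0 /fsubsetP lS; apply/undercutsP; rewrite in_initial ltnn andbF; split=> //.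
  by apply: lS; rewrite in_initial ltnSn.
move=> [|t]; first by rewrite in_initial (negPf S0).
rewrite ltnS => tl; rewrite in_initial tl; apply: lS.
by rewrite in_initial /= ltnW.
Qed.

Lemma undercuts_initial_gt (S : {fset nat}) l s :
  0%N \notin S -> undercuts S (initial l) s -> (l < s)%N.
Proof.
move=> S0 /undercutsP[sS]; rewrite in_initial negb_and -leqNgt leqn0 -ltnNge.
by case/orP => // /eqP s0; move: S0; rewrite -s0 sS.
Qed.

(** As 0 is excluded, a bid of [S] outside {1..l} exceeds l; if it decides the auction, both sets
    agree below it, so [S] contains all of {1..l}. *)
Lemma beats_initial (S : {fset nat}) l :
  0%N \notin S -> beats S (initial l) = (initial l `<` S).
Proof.
move=> S0; apply/idP/idP => [/beatsP[s us]|].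
  have ls := undercuts_initial_gt S0 us; have /undercutsP[sS sl h] := us.
  rewrite fproperEneq; apply/andP; split.
    by apply: contraNneq sl => ->.
  apply/fsubsetP => t tl; rewrite h //; move: tl; rewrite in_initial => /andP[_ tl].
  exact: leq_ltn_trans ls.
move=> lS; have /beats_total/orP[//|] : S != initial l.
  by move: lS; rewrite fproperEneq eq_sym => /andP[].
move=> /beatsP[s /undercutsP[sl]]; have /fsubsetP/(_ _ sl) -> // := fproper_sub lS.
Qed.

(** * Bounded strategies, and sums over them split along the sets {1..l} *)

Section Bounded.
Variables (R : realType) (v c : R).
Implicit Types (S T : {fset nat}) (F : {fset nat} -> R).

Lemma boundedP S :
  reflect [/\ 0%N \notin S, forall s, s \in S -> s%:R <= v & #|` S|%:R <= v / c]
          (bounded v c S).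
Proof.
apply: (iffP and3P) => -[S0 Sv Sc]; split => //.
  by move=> s sS; exact: (forallP Sv [` sS]).
by apply/forallP => s; apply: Sv; exact: fsvalP.
Qed.

Lemma bounded_sub S T : T `<=` S -> bounded v c S -> bounded v c T.
Proof.
move=> TS /boundedP[S0 Sv Sc]; apply/boundedP; split.
- by apply: contraNN S0; apply/fsubsetP.
- by move=> s /(fsubsetP TS)/Sv.
- by apply: le_trans Sc; rewrite ler_nat fsubset_leq_card.
Qed.

Lemma bounded_initial l : l%:R <= v -> l%:R <= v / c -> bounded v c (initial l).
Proof.
move=> lv lc; apply/boundedP; split; rewrite ?in_initial ?card_initial //.
by move=> s; rewrite in_initial => /andP[_ sl]; rewrite (le_trans _ lv) ?ler_nat.
Qed.

Lemma bounded_initialS S l :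
  bounded v c S -> initial l `<` S -> bounded v c (initial l.+1).
Proof.
move=> /boundedP[S0 Sv Sc] lS; apply: bounded_initial.
  move: (lS); rewrite -beats_initial // => /beatsP[s us].
  have ls := undercuts_initial_gt S0 us; have /undercutsP[sS _ _] := us.
  by rewrite (le_trans _ (Sv _ sS)) ?ler_nat.
rewrite (le_trans _ Sc) // ler_nat -{1}(card_initial l).
exact: fproper_ltn_card.
Qed.

(* S is one of {}, {1}, .., {1..K}. *)
Definition stair K S : bool := (S == initial #|` S|) && (#|` S| <= K)%N.

Lemma stair_initial K l : stair K (initial l) = (l <= K)%N.
Proof. by rewrite /stair card_initial eqxx. Qed.

Lemma sum_strategies F K : bounded v c (initial K) ->
  \sum_(S : strategies v c) F (val S) =
    \sum_(l < K.+1) F (initial l)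
    + \sum_(S : strategies v c | ~~ stair K (val S)) F (val S).
Proof.
move=> bK; rewrite (bigID (fun S : strategies v c => stair K (val S))) /=; congr (_ + _).
have bl (l : 'I_K.+1) : initial l \in strategies v c.
  rewrite in_strategies; apply: bounded_sub bK.
  by rewrite sub_initial // -ltnS.
rewrite (reindex_onto (fun l : 'I_K.+1 => [` bl l])
  (fun S : strategies v c => inord #|` val S|)) /=.
  apply: eq_big => [l|//]; rewrite stair_initial -ltnS ltn_ord card_initial.
  by rewrite inord_val eqxx.
move=> S /andP[/eqP Si Sk]; apply/val_inj => /=.
by rewrite inordK ?ltnS // -Si.
Qed.

Lemma gain_initial S l :
  0%N \notin S -> initial l.+1 `<=` S -> gain v S (initial l) = v - l.+1%:R.
Proof. by move=> S0 lS; apply/gain_undercuts/undercuts_initial. Qed.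

Lemma gain_fset0 T : gain v fset0 T = 0.
Proof. by apply/gain0/negP => /beatsP[s /undercutsP[]]; rewrite in_fset0. Qed.

Lemma gain_initial_ge S K l : 0%N \notin S -> initial K `<=` S -> (l < K)%N ->
  gain v S (initial l) = v - l.+1%:R.
Proof.
by move=> S0 KS lK; rewrite gain_initial // (fsubset_trans _ KS) ?sub_initial.
Qed.

End Bounded.

(** * Equilibrium as indifference, and the threshold K *)

Section Equilibrium.
Variables (R : realType) (v c : R).
Hypotheses (v_ge0 : 0 <= v) (c_gt0 : 0 < c).
Implicit Types (S T : {fset nat}) (sigma tau : {fset nat} -> R).

Lemma mixed_pure S : bounded v c S -> mixed v c (fun T => (T == S)%:R).
Proof.
move=> bS; split=> [T|T|]; first by rewrite ler0n.
  by case: eqVneq => [->|//]; rewrite bS.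
have Ss : S \in strategies v c by rewrite in_strategies.
rewrite (bigD1 [` Ss]) //= eqxx big1 ?addr0 // => T.
by rewrite -val_eqE /= => /negPf->.
Qed.

Lemma expected_payoff_deviation sigma tau (i : 'I_2) : mixed v c sigma ->
  expected_payoff v c (fun j => if j == i then tau else sigma) i =
    \sum_(S : strategies v c) tau (val S) * value v c sigma (val S).
Proof.
have ri : (rev_ord i == i) = false by apply/negbTE; rewrite neq_ord2.
by move=> ms; rewrite expected_payoff2 ?eqxx ?ri.
Qed.

(** Pure deviations bound every value by the mean [w]; the gaps to [w] are then nonnegative with
    weighted sum 0, so they vanish on the support. *)
Lemma symmetric_equilibriumP sigma :
  symmetric_equilibrium v c 2 sigma <->
  mixed v c sigma /\ exists w,
    (forall S, bounded v c S -> value v c sigma S <= w) /\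
    (forall S, 0 < sigma S -> value v c sigma S = w).
Proof.
split=> [[ms eqs]|[ms [w [lew eqw]]]].
  have {}ms := ms ord0; split => //.
  pose w := \sum_(S : strategies v c) sigma (val S) * value v c sigma (val S).
  have lew S : bounded v c S -> value v c sigma S <= w.
    move=> bS; have := eqs ord0 _ (mixed_pure bS).
    rewrite expected_payoff_deviation // expected_payoff2 //.
    have Ss : S \in strategies v c by rewrite in_strategies.
    rewrite (bigD1 [` Ss]) //= eqxx mul1r big1 ?addr0 // => T.
    by rewrite -val_eqE /= => /negPf->; rewrite mul0r.
  exists w; split => // S S0; have [ge0 out sum1] := ms.
  have bS : bounded v c S by apply: contraTT S0 => /out->; rewrite ltxx.
  have Ss : S \in strategies v c by rewrite in_strategies.
  have : \sum_(T : strategies v c) sigma (val T) * (w - value v c sigma (val T)) = 0.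
    under eq_bigr do rewrite mulrBr.
    by rewrite sumrB -mulr_suml sum1 mul1r subrr.
  move/psumr_eq0P => /(_ _ [` Ss] isT) /=.
  move=> /(_ _)/eqP; rewrite mulf_eq0 gt_eqF //= subr_eq0 => h.
  apply/esym/eqP/h => T _; rewrite mulr_ge0 // subr_ge0 lew // -in_strategies.
  exact: fsvalP.
split=> // i tau mt; rewrite expected_payoff_deviation // expected_payoff2 //.
have [ge0 out sum1] := ms; have [tge0 tout tsum1] := mt.
have -> : \sum_(S : strategies v c) sigma (val S) * value v c sigma (val S) = w.
  rewrite -[RHS]mul1r -sum1 mulr_suml; apply: eq_bigr => S _.
  have := ge0 (val S); rewrite le_eqVlt => /orP[/eqP<-|/eqw->//].
  by rewrite !mul0r.
rewrite -[w]mul1r -tsum1 mulr_suml ler_sum // => S _.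
by rewrite ler_wpM2l // lew // -in_strategies fsvalP.
Qed.

(* K satisfies the inequalities defining N, except that K = 0 is allowed: this   *)
(* covers the case v <= 1 + c, where no N exists and the empty set is played.    *)
Definition good K : Prop :=
  [/\ K%:R <= v, (0 < K)%N -> K%:R < v & \sum_(l < K) c / (v - l.+1%:R) < 1].

Definition staircase K S : R :=
  if stair K S then
    if (#|` S| < K)%N then c / (v - #|` S|.+1%:R)
    else 1 - \sum_(l < K) c / (v - l.+1%:R)
  else 0.

Lemma goodW K L : (K <= L)%N -> good L -> good K.
Proof.
move=> KL [Lv Lv' Lc].
have h l : (l < L)%N -> 0 < v - l.+1%:R.
  by move=> lL; rewrite subr_gt0 (le_lt_trans _ (Lv' _)) ?ler_nat // (leq_trans _ lL).
split.
- by rewrite (le_trans _ Lv) ?ler_nat.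
- by move=> K0; rewrite (le_lt_trans _ (Lv' _)) ?ler_nat // (leq_trans K0).
- apply: le_lt_trans Lc; rewrite (big_ord_widen _ (fun l => c / (v - l.+1%:R)) KL).
  rewrite [leRHS](bigID (fun l : 'I_L => (l < K)%N)) /= lerDl sumr_ge0 // => l _.
  by rewrite divr_ge0 ?ltW // h.
Qed.

Lemma good0 : good 0.
Proof. by split; rewrite // big_ord0 ltr01. Qed.

(** The limit on the number of bids holds because each of the K summands is at least c/v, whence K
    c/v < 1. *)
Lemma good_bounded K : good K -> bounded v c (initial K).
Proof.
move=> [Kv Kv' Kc]; apply: bounded_initial => //.
case: K Kv Kv' Kc => [|K] Kv Kv' Kc; first by rewrite divr_ge0 // ltW.
have v0 : 0 < v by rewrite (le_lt_trans _ (Kv' _)).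
rewrite ler_pdivlMr // -[v]mul1r -ler_pdivrMr // ltW //; apply: le_lt_trans Kc.
rewrite -mulrA mulr_natl -{1}(card_ord K.+1) -sumr_const.
apply: ler_sum => l _; rewrite ler_wpM2l ?(ltW c_gt0) // lef_pV2 ?posrE //.
  by rewrite gerBl ler0n.
by rewrite subr_gt0 (le_lt_trans _ (Kv' _)) ?ler_nat.
Qed.

Lemma good_lt K : good K -> forall l, (l < K)%N -> 0 < v - l.+1%:R.
Proof.
move=> [_ Kv _] l lK; rewrite subr_gt0 (le_lt_trans _ (Kv _)) ?ler_nat //.
exact: leq_trans lK.
Qed.

(** Since [good] is closed downwards ([goodW]), failure at [K.+1] amounts to maximality of K. *)
Definition last_good K := good K /\ ~ good K.+1.

Lemma last_good_uniq K L : last_good K -> last_good L -> K = L.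
Proof.
move=> [gK nK] [gL nL]; case: (ltngtP K L) => // h.
- by case: nK; exact: goodW gL.
- by case: nL; exact: goodW gK.
Qed.

Lemma last_good_exists : exists K, last_good K.
Proof.
apply: contrapT => /forallNP h.
have {}h K : good K.
  elim: K => [|K IH]; first exact: good0.
  by apply: contrapT => nK; exact: (h K).
have [+ _ _] := h (Num.truncn v).+1.
by rewrite leNgt truncnS_gt.
Qed.

(** * Existence: the staircase strategy is an equilibrium *)

Section Existence.
Variables (K : nat).
Hypotheses (gK : good K) (nK : ~ good K.+1).

Let w l := staircase K (initial l).

Lemma staircase_initial l : (l < K)%N -> w l = c / (v - l.+1%:R).
Proof. by move=> lK; rewrite /w /staircase stair_initial card_initial ltnW // lK. Qed.

Lemma staircase_last : w K = 1 - \sum_(l < K) c / (v - l.+1%:R).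
Proof. by rewrite /w /staircase stair_initial card_initial leqnn ltnn. Qed.

Lemma staircase_ge0 S : 0 <= staircase K S.
Proof.
rewrite /staircase; case: ifP => // _; case: ifP => [/(good_lt gK) h|_].
  by rewrite divr_ge0 ?ltW.
by have [_ _ h] := gK; rewrite subr_ge0 ltW.
Qed.

Lemma staircase_mul l : (l < K)%N -> w l * (v - l.+1%:R) = c.
Proof.
move=> lK; rewrite staircase_initial // divfK // gt_eqF //.
exact: good_lt lK.
Qed.

(** This is where maximality of K enters: for v > K+1, a remainder above c/(v-(K+1)) would make
    [K.+1] good; otherwise the left side is at most 0. *)
Lemma staircase_mul_last : w K * (v - K.+1%:R) <= c.
Proof.
have [vK|vK] := leP v K.+1%:R.
  by rewrite (le_trans _ (ltW c_gt0)) // mulr_ge0_le0 ?staircase_ge0 // subr_le0.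
rewrite -ler_pdivlMr ?subr_gt0 // staircase_last lerBlDl leNgt; apply/negP => h.
by apply: nK; split; rewrite ?ltW // big_ord_recr.
Qed.

Lemma staircase_mixed : mixed v c (staircase K).
Proof.
split=> [S|S|]; first exact: staircase_ge0.
  rewrite /staircase; case: ifP => // /andP[/eqP SE SK] /negP[].
  by rewrite SE; apply: bounded_sub (good_bounded gK); exact: sub_initial.
rewrite (sum_strategies _ (good_bounded gK)) [X in _ + X]big1 => [|S /negPf nS].
  rewrite addr0 big_ord_recr /= -/(w K) staircase_last.
  under eq_bigr => l _ do rewrite -/(w l) staircase_initial //.
  by rewrite addrC subrK.
by rewrite /staircase nS.
Qed.

Lemma value_staircase S : value v c (staircase K) S =
  \sum_(l < K.+1) w l * gain v S (initial l) - c * #|` S|%:R.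
Proof.
congr (_ - _); rewrite (sum_strategies (fun T => staircase K T * gain v S T) (good_bounded gK)).
rewrite [X in _ + X]big1 ?addr0 // => T /negPf nT.
by rewrite /staircase nT mul0r.
Qed.

Lemma value_staircase_le0 S : bounded v c S -> value v c (staircase K) S <= 0.
Proof.
move=> bS; have [S0 _ _] := boundedP _ _ _ bS.
rewrite value_staircase subr_le0.
have le (l : 'I_K.+1) : w l * gain v S (initial l) <= if (l < #|` S|)%N then c else 0.
  have [lS|] := boolP (beats S (initial l)); last first.
    by move/gain0 => ->; rewrite mulr0; case: ifP => // _; exact: ltW.
  have -> : (l < #|` S|)%N.
    by rewrite -[X in (X < _)%N]card_initial fproper_ltn_card // -beats_initial.
  have /beatsP[s us] := lS; rewrite (gain_undercuts _ us).
  apply: (@le_trans _ _ (w l * (v - l.+1%:R))).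
    rewrite ler_wpM2l ?staircase_ge0 // lerB // ler_nat.
    exact: undercuts_initial_gt us.
  have := ltn_ord l; rewrite ltnS leq_eqVlt => /orP[/eqP->|lK].
    exact: staircase_mul_last.
  by rewrite staircase_mul.
apply: (le_trans (ler_sum _ (fun l _ => le l))).
rewrite -big_mkcond /= sumr_const mulr_natr; apply: ler_wpMn2l; first exact: ltW.
rewrite cardE -(size_map val) -[leqRHS](size_iota 0); apply: uniq_leq_size.
  by rewrite (map_inj_uniq val_inj) enum_uniq.
by move=> _ /mapP[l + ->]; rewrite mem_enum mem_iota unfold_in.
Qed.

(** Each of the l lower steps yields exactly c, which pays for the l bids; the other steps are not
    beaten. *)
Lemma value_staircase_initial l :
  (l <= K)%N -> value v c (staircase K) (initial l) = 0.
Proof.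
move=> lK; rewrite value_staircase card_initial.
rewrite -(big_mkord xpredT (fun k => w k * gain v (initial l) (initial k))).
rewrite (big_cat_nat _ (n := l)) ?leqW //=.
rewrite [X in _ + X - _]big_nat [X in _ + X - _]big1 => [|k /andP[lk _]]; last first.
  rewrite gain0 ?mulr0 // beats_initial ?in_initial //.
  by apply/negP => /fproper_ltn_card; rewrite !card_initial ltnNge lk.
rewrite (@eq_big_nat _ _ _ _ _ _ (fun=> c)) => [|k /andP[_ kl]]; last first.
  rewrite gain_initial ?in_initial ?sub_initial // staircase_mul //.
  exact: leq_trans lK.
by rewrite sumr_const_nat subn0 addr0 mulr_natr subrr.
Qed.

Lemma staircase_equilibrium : symmetric_equilibrium v c 2 (staircase K).
Proof.
apply/symmetric_equilibriumP; split; first exact: staircase_mixed.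
exists 0; split=> S; first exact: value_staircase_le0.
rewrite /staircase; case: ifP => [/andP[/eqP SE lK] _|]; last by rewrite ltxx.
by rewrite SE; exact: value_staircase_initial.
Qed.

End Existence.

(** * Uniqueness: climbing the support of an equilibrium *)

Section Uniqueness.
Variable tau : {fset nat} -> R.
Hypothesis mt : mixed v c tau.
Variable w : R.
Hypothesis value_le : forall S, bounded v c S -> value v c tau S <= w.
Hypothesis value_eq : forall S, 0 < tau S -> value v c tau S = w.

Lemma mixed_bounded S : 0 < tau S -> bounded v c S.
Proof. by have [_ out _] := mt; apply: contraTT => /out->; rewrite ltxx. Qed.

Lemma mixed_gt0P S : tau S = 0 \/ 0 < tau S.
Proof.
have [ge0 _ _] := mt.
by have := ge0 S; rewrite le_eqVlt => /orP[/eqP<-|]; [left|right].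
Qed.

Lemma bounded_fset0 : bounded v c fset0.
Proof. by rewrite -initial0; exact: good_bounded good0. Qed.

Lemma value_fset0 : value v c tau fset0 = 0.
Proof.
rewrite /value cardfs0 mulr0 subr0 big1 // => T _.
by rewrite gain_fset0 mulr0.
Qed.

Lemma support_fset0 : 0 < tau fset0.
Proof.
have [ge0 _ sum1] := mt.
have [S0 tS0] : exists S : strategies v c, 0 < tau (val S).
  apply: contrapT => /forallNP h; have /eqP := sum1; rewrite big1.
    by rewrite eq_sym oner_eq0.
  by move=> S _; case: (mixed_gt0P (val S)) => // /h.
have [S tS mS] := @exists_weakest _ val (fun S : strategies v c => 0 < tau (val S)) _ tS0.
have : value v c tau (val S) = - (c * #|` val S|%:R).
  rewrite /value big1 ?add0r // => T _.
  have [->|tT] := mixed_gt0P (val T); first by rewrite mul0r.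
  rewrite gain0 ?mulr0 //; have [->|TS] := eqVneq (val T) (val S).
    by rewrite beats_irr.
  exact: beats_asym (mS _ tT TS).
have := value_le bounded_fset0; rewrite value_fset0 -(value_eq tS) => /[swap] ->.
rewrite oppr_ge0 pmulr_rle0 // lern0 cardfs_eq0 => /eqP S_0.
by rewrite -S_0.
Qed.

Lemma value_eq0 : w = 0.
Proof. by rewrite -(value_eq support_fset0) value_fset0. Qed.

(* The support of tau starts, in lexicographic order, with {}, {1}, .., {1..K}. *)
Definition chain K : Prop :=
  [/\ 0 < tau (initial K),
      forall l, (l < K)%N -> tau (initial l) * (v - l.+1%:R) = c
    & forall S, 0 < tau S -> stair K S \/ initial K `<` S].

Lemma chain0 : chain 0.
Proof.
rewrite /chain initial0; split=> // [|S _]; first exact: support_fset0.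
rewrite fproper0; case: eqVneq => [->|_]; last by right.
by left; rewrite -initial0 stair_initial.
Qed.

(** The indifference equations of the chain make each of the K lower steps contribute c. *)
Lemma chain_value K S : chain K -> bounded v c S -> initial K `<` S ->
  value v c tau S = c * K%:R + tau (initial K) * gain v S (initial K)
    + \sum_(T : strategies v c | ~~ stair K (val T)) tau (val T) * gain v S (val T)
    - c * #|` S|%:R.
Proof.
move=> [tK tl _] /boundedP[S0 _ _] KS; congr (_ - _).
rewrite (sum_strategies (fun T => tau T * gain v S T) (mixed_bounded tK)); congr (_ + _).
rewrite big_ord_recr /=; congr (_ + _).
rewrite (eq_bigr (fun=> c)) ?sumr_const ?card_ord ?mulr_natr // => l _.
by rewrite (gain_initial_ge v S0 (fproper_sub KS)) // tl.
Qed.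

Lemma chain_deviation K : chain K -> bounded v c (initial K.+1) ->
  tau (initial K) * (v - K.+1%:R) <= c.
Proof.
move=> cK bK; have KS : initial K `<` initial K.+1.
  by rewrite fproperEcard sub_initial // !card_initial /=.
have := value_le bK; rewrite value_eq0 (chain_value cK bK KS) card_initial.
rewrite gain_initial ?in_initial // subr_le0.
have [ge0 _ _] := mt.
have : 0 <= \sum_(T : strategies v c | ~~ stair K (val T))
            tau (val T) * gain v (initial K.+1) (val T).
  by apply: sumr_ge0 => T _; rewrite mulr_ge0 // (gain_ge0 _ bK).
by rewrite -natr1; lra.
Qed.

Lemma chain_step K :
  chain K -> (forall S, 0 < tau S -> stair K S) \/ chain K.+1.
Proof.
move=> cK; have [tK tl tS] := cK.
have [|nh] := pselect (forall S, 0 < tau S -> stair K S); [by left|right].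
pose P (S : strategies v c) := (0 < tau (val S)) && ~~ stair K (val S).
have [S0 PS0] : exists S0 : strategies v c, P S0.
  apply: contrapT => /forallNP h; apply: nh => S S0; apply/negPn/negP => nS.
  have Ss : S \in strategies v c by rewrite in_strategies mixed_bounded.
  by apply: (h [` Ss]); rewrite /P /= S0.
(* [S] is the next element of the support above {1..K}. *)
have [{S0 PS0} [S Ss] /andP[/= S0 nS] mS] := @exists_weakest _ val P _ PS0.
have bS := mixed_bounded S0; have [zS _ _] := boundedP _ _ _ bS.
have KS : initial K `<` S by case: (tS _ S0) => // sS; rewrite sS in nS.
have bK := bounded_initialS bS KS.
have dev := chain_deviation cK bK.
have /beatsP[s us] : beats S (initial K) by rewrite beats_initial.
have Ks := undercuts_initial_gt zS us.
have cS : (K < #|` S|)%N by rewrite -{1}(card_initial K) fproper_ltn_card.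
(* Against the support outside the steps [S] gains nothing: it ties with itself and loses to all the
   others. *)
have := value_eq S0; rewrite value_eq0 (chain_value cK bS KS) big1 ?addr0; last first.
  move=> T nT; have [->|tT] := mixed_gt0P (val T); first by rewrite mul0r.
  rewrite gain0 ?mulr0 //; have [->|TS] := eqVneq (val T) S.
    by rewrite beats_irr.
  by apply/beats_asym/(mS T) => //; rewrite /P tT.
rewrite (gain_undercuts _ us) => eqS.
(* With [eqS] and [dev], these bounds close a cycle of inequalities from c|S| back to c|S|, so all
   are equalities; this forces |S| = K+1, s = K+1 and the indifference equation at K. *)
have les : tau (initial K) * (v - s%:R) <= tau (initial K) * (v - K.+1%:R).
  by rewrite ler_pM2l // lerB // ler_nat.
have lec : c * K.+1%:R <= c * #|` S|%:R by rewrite ler_pM2l // ler_nat.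
have cKS : c * K.+1%:R = c * K%:R + c by rewrite -natr1 mulrDr mulr1.
have eqc : c * #|` S|%:R = c * K.+1%:R by lra.
have eqt : tau (initial K) * (v - s%:R) = tau (initial K) * (v - K.+1%:R) by lra.
have cardS : #|` S| = K.+1.
  by move/(mulfI (lt0r_neq0 c_gt0))/eqP: eqc; rewrite eqr_nat => /eqP.
have sK : s = K.+1.
  by move/(mulfI (lt0r_neq0 tK))/addrI/oppr_inj/eqP: eqt; rewrite eqr_nat => /eqP.
have SK : S = initial K.+1.
  apply/esym/eqP; rewrite eqEfcard cardS card_initial leqnn andbT initialS -sK.
  by rewrite fsubUset fsub1set fproper_sub // andbT; case/undercutsP: us.
split; first by rewrite -SK.
- move=> l; rewrite ltnS leq_eqVlt => /orP[/eqP->|]; last exact: tl.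
  by apply/eqP; rewrite eq_le dev /=; lra.
- move=> T tT; case: (tS T tT) => [/andP[eT lT]|KT].
    by left; rewrite /stair eT leqW.
  have [TS|TS] := eqVneq T S; first by left; rewrite TS SK stair_initial.
  have bT := mixed_bounded tT; have Ts : T \in strategies v c by rewrite in_strategies.
  right; have [zT _ _] := boundedP _ _ _ bT; rewrite -(beats_initial _ zT) -SK.
  apply: (mS [` Ts]) => //; rewrite /P /= tT; apply/negP => /andP[_ lT].
  by move: (fproper_ltn_card KT); rewrite card_initial ltnNge lT.
Qed.

(** An endless chain would put a bid above v into the support. *)
Lemma chain_end : exists2 K, chain K & forall S, 0 < tau S -> stair K S.
Proof.
apply: contrapT => h; have {}h K : chain K.
  elim: K => [|K IH]; first exact: chain0.
  by have [st|//] := chain_step IH; case: h; exists K.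
have [tK _ _] := h (Num.truncn v).+1.
have /boundedP[_ /(_ (Num.truncn v).+1) + _] := mixed_bounded tK.
by rewrite in_initial leqnn leNgt truncnS_gt => /(_ isT).
Qed.

Lemma chain_end_staircase K :
  chain K -> (forall S, 0 < tau S -> stair K S) -> last_good K /\ tau = staircase K.
Proof.
move=> cK st; have [tK tl tS] := cK; have [ge0 _ sum1] := mt.
have bK := mixed_bounded tK.
have n0 l : (l < K)%N -> v - l.+1%:R != 0.
  by move=> /tl; case: eqVneq => // ->; rewrite mulr0 => c0; move: c_gt0; rewrite -c0 ltxx.
have tlE l : (l < K)%N -> tau (initial l) = c / (v - l.+1%:R).
  by move=> lK; rewrite -(tl _ lK) mulfK // n0.
have tKE : tau (initial K) = 1 - \sum_(l < K) c / (v - l.+1%:R).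
  have := sum1; rewrite (sum_strategies _ bK) [X in _ + X]big1 => [|S /negP nS].
    rewrite addr0 big_ord_recr /=; under eq_bigr => l _ do rewrite tlE //.
    by move=> s1; apply/eqP; rewrite eq_sym subr_eq addrC s1.
  by have [|/st/nS] := mixed_gt0P (val S).
have gK : good K.
  (* Boundedness gives K <= v; K = v would turn the chain equation at K-1 into 0 = c. *)
  have Kv : (0 < K)%N -> K%:R < v.
    move=> K0; have [_ /(_ K) + _] := boundedP _ _ _ bK.
    rewrite in_initial K0 leqnn => /(_ isT); rewrite le_eqVlt => /orP[/eqP eK|//].
    by move: (n0 K.-1); rewrite prednK // leqnn -eK subrr eqxx => /(_ isT).
  split=> //; first by case: (posnP K) => [->//|/Kv/ltW].
  by rewrite -subr_gt0 -tKE.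
split.
  (* Were [K.+1] good, the mass left on {1..K} would exceed c/(v-(K+1)) and the deviation to
     {1..K+1} would be profitable. *)
  split=> // gK1; have [_ /(_ isT) Kv Kc] := gK1.
  have := chain_deviation cK (good_bounded gK1).
  rewrite -ler_pdivlMr ?subr_gt0 // tKE lerBlDl leNgt => /negP; apply.
  by move: Kc; rewrite big_ord_recr.
apply/funext => S; rewrite /staircase; case: ifP => [/andP[/eqP SE SK]|/negP nS].
  case: ifP => lK; first by rewrite {1}SE tlE.
  have cS : #|` S| = K by apply/eqP; rewrite eqn_leq SK leqNgt lK.
  by rewrite SE cS tKE.
by have [|/st/nS] := mixed_gt0P S.
Qed.

End Uniqueness.

(** * Conclusion, and identification of K with N *)

Lemma equilibrium_staircase tau : symmetric_equilibrium v c 2 tau ->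
  exists2 K, last_good K & tau = staircase K.
Proof.
move/symmetric_equilibriumP => [mt [w [le_w eq_w]]].
have [K cK st] := chain_end mt le_w eq_w.
by have [? ?] := chain_end_staircase mt le_w eq_w cK st; exists K.
Qed.

Lemma maximal_admissible_last_good N : maximal_admissible v c N -> last_good N.
Proof.
have sumE M : \sum_(1 <= k < M.+1) c / (v - k%:R) = \sum_(l < M) c / (v - l.+1%:R).
  by rewrite big_add1 big_mkord.
move=> [[N0 Nv Nc] maxN]; split; first by split; rewrite ?ltW // -sumE.
move=> [_ /(_ isT) Nv1 Nc1]; suff /maxN : admissible v c N.+1 by rewrite ltnn.
by split; rewrite // sumE.
Qed.

End Equilibrium.

Theorem theorem3p2 (R : realType) (v c : R) (hv : 0 <= v) (hc : 0 < c) :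
  exists sigma : {fset nat} -> R,
    [/\ symmetric_equilibrium v c 2 sigma,
        forall tau, symmetric_equilibrium v c 2 tau -> tau = sigma
      & forall N : nat, maximal_admissible v c N ->
          [/\ sigma fset0 = c / (v - 1),
              forall l : nat, (1 <= l <= N.-1)%N ->
                sigma (initial l) = c / (v - l.+1%:R)
            & sigma (initial N) = 1 - \sum_(0 <= l < N) c / (v - l.+1%:R)]].
Proof.
have [K lK] := last_good_exists c hv; have [gK nK] := lK.
exists (staircase v c K); split; first exact: staircase_equilibrium.
  move=> tau /(equilibrium_staircase hv hc)[L lL ->].
  by rewrite (last_good_uniq hc lK lL).
move=> N maxN; have N0 : (0 < N)%N by case: maxN => -[].
have -> := last_good_uniq hc lK (maximal_admissible_last_good maxN).
split; first by rewrite -initial0 staircase_initial.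
  move=> l /andP[_ lN]; rewrite staircase_initial //.
  by rewrite (leq_ltn_trans lN) // prednK.
by rewrite staircase_last big_mkord.
Qed.
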